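(* Let $r\ge k\ge 2$ be integers, and let $H$ be an $r$-uniform hypergraph. If every hyperedge of $H$ intersects at most $$\frac{1}{e\,\Biggl(1-\dfrac{1}{k^r}\displaystyle\sum_{j=0}^{k}(-1)^{k-j}\binom{k}{j}\,j^{\,r}\Biggr)}$$ other hyperedges, then $H$ admits a $k$-coloring in which each hyperedge contains all colors.
   Context: A hypergraph $H=(V,E)$ consists of a set of vertices $V$ and a collection $E$ of subsets of $V$, called hyperedges. $H$ is $r$-uniform if each hyperedge has size $r$. A $k$-coloring is a map $V\to\{1,\ldots,k\}$; a hyperedge contains all colors if each of the $k$ colors is assigned to at least one of its vertices. $e$ is the base of the natural logarithm. *)

(* Defs.v *)
From HB Require Import structures.
From mathcomp Require Import all_boot all_order all_algebra.
From mathcomp Require Import all_classical all_reals all_analysis.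
Set Implicit Arguments.
Unset Strict Implicit.
Unset Printing Implicit Defensive.
Import Order.TTheory GRing.Theory Num.Theory.
Local Open Scope classical_set_scope.
Local Open Scope card_scope.
Local Open Scope ring_scope.

(* The vertex set is the whole type vertex; neither it nor the set of
   hyperedges is required to be finite. *)
Record hypergraph := Hypergraph {
  vertex : Type;
  hyperedges : set (set vertex) }.

Arguments hyperedges : clear implicits.

Definition uniform (r : nat) (H : hypergraph) : Prop :=
  forall A : set (vertex H), hyperedges H A -> A #= `I_r.

Definition neighbors (H : hypergraph) (A : set (vertex H)) :
    set (set (vertex H)) :=
  [set B | [/\ hyperedges H B, B <> A & A `&` B !=set0]].

(* In particular a set of cardinality at most x is finite. *)
Definition card_at_most (R : realType) (T : Type) (X : set T) (x : R) : Prop :=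
  exists2 n : nat, X #= `I_n & n%:R <= x.

(* The k colors are the elements 0, ..., k-1 of 'I_k. *)
Definition contains_all_colors (V : Type) (k : nat) (c : V -> 'I_k)
    (A : set V) : Prop :=
  forall i : 'I_k, exists2 v : V, A v & c v = i.

(* Main.v *)
(* Color the vertices uniformly at random and let q be the probability that a
   fixed hyperedge misses a color; inclusion-exclusion gives q, so the degree d
   satisfies e q d <= 1.  The usual symmetric local lemma needs
   e q (d + 1) <= 1, so Shearer's sharpening is used: when the bad events are
   revealed along edges of the dependency graph, one neighbour is always left
   out of the conditioning set, so that only d - 1 factors 1 - a are lost, and
   the conditional probabilities stay below a = 1/d because
   q <= 1/(e d) <= (1/d) (1 - 1/d)^(d - 1).  The last step, where all d
   neighbours may be conditioned on, only needs q < (1 - a)^d.  Infinite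
   hypergraphs follow by an ultrafilter (compactness) argument, hyperedges
   being finite. *)
Require Import Defs.
From HB Require Import structures.
From mathcomp Require Import all_boot all_order all_algebra finmap.
From mathcomp Require Import all_classical all_reals all_analysis.
From mathcomp Require Import ring lra.
Set Implicit Arguments.
Unset Strict Implicit.
Unset Printing Implicit Defensive.
Import Order.TTheory GRing.Theory Num.Theory.
Local Open Scope ring_scope.

(** * The local lemma in Shearer's form, by counting outcomes *)

Section LocalLemma.
Variables (R : realFieldType) (Omega I : finType) (bad : I -> {set Omega}).
Variables (adj : rel I) (p a : R) (d : nat).

(** The measure is uniform on [Omega] and all bounds compare cardinalities, so a conditional bound
    needs no division and makes sense even when [avoid S] is empty. *)
Definition avoid (S : {set I}) : {set Omega} := \bigcap_(j in S) ~: bad j.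

Lemma avoidS (S S' : {set I}) : S \subset S' -> avoid S' \subset avoid S.
Proof.
move=> sS; apply/fintype.subsetP => w /bigcapP hw; apply/bigcapP => j jS.
exact/hw/(fintype.subsetP sS).
Qed.

Lemma card_avoidU1 (S : {set I}) (i : I) :
  #|avoid (i |: S)|%:R = #|avoid S|%:R - #|bad i :&: avoid S|%:R :> R.
Proof.
have -> : avoid (i |: S) = avoid S :\: bad i.
  apply/setP => w; rewrite !inE; apply/bigcapP/andP.
    move=> hw; split; first by have := hw i; rewrite !inE eqxx; apply.
    by apply/bigcapP => j jS; apply: hw; rewrite !inE jS orbT.
  move=> [wi /bigcapP hw] j; rewrite !inE => /orP[/eqP->//|/hw].
  by rewrite inE.
by rewrite finset.setIC -(cardsID (bad i) (avoid S)) natrD addrAC subrr add0r.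
Qed.

Hypothesis adj_sym : symmetric adj.
Hypothesis adj_deg : forall i, (#|[set j | adj i j]| <= d)%N.
Hypothesis bad_indep : forall (i : I) (S : {set I}), i \notin S ->
  (forall j, j \in S -> ~~ adj i j) ->
  #|bad i :&: avoid S|%:R <= p * #|avoid S|%:R.
Hypothesis a_ge0 : 0 <= a.
Hypothesis a_lt1 : a < 1.
Hypothesis p_le : p <= a * (1 - a) ^+ d.-1.
Hypothesis p_lt : p < (1 - a) ^+ d.
Hypothesis Omega_gt0 : (0 < #|Omega|)%N.

Let N (i : I) : {set I} := [set j | adj i j].
Let a1_ge0 : 0 <= 1 - a. Proof. by rewrite subr_ge0 ltW. Qed.
Let a1_le1 : 1 - a <= 1. Proof. by rewrite gerBl. Qed.

(** Chain rule: the events of [Y] are added one at a time, and each leaves at least a fraction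
    [1 - a] of the outcomes. Disjointness keeps the event being added out of the conditioning
    set. *)
Lemma avoid_chain (X Y : {set I}) :
  (forall (i : I) (S : {set I}), i \in Y -> S \subset X :|: Y -> i \notin S ->
    #|bad i :&: avoid S|%:R <= a * #|avoid S|%:R) ->
  [disjoint X & Y] ->
  (1 - a) ^+ #|Y| * #|avoid X|%:R <= #|avoid (X :|: Y)|%:R.
Proof.
move: {2}#|Y| (erefl #|Y|) => n; elim: n Y => [|n IH] Y hY hbad dXY.
  move/eqP: hY; rewrite cards_eq0 => /eqP->.
  by rewrite finset.cards0 expr0 mul1r finset.setU0.
have /card_gt0P[i iY] : (0 < #|Y|)%N by rewrite hY.
have iX : i \notin X by rewrite (disjointFl dXY iY).
have hYi : #|Y :\ i| = n by move: hY; rewrite (cardsD1 i) iY add1n => -[].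
have sYi : Y :\ i \subset Y by apply: finset.subsetDl.
have {}IH := IH _ hYi _ (disjointWr sYi dXY).
have /IH {}IH : forall (j : I) (S : {set I}), j \in Y :\ i ->
    S \subset X :|: Y :\ i -> j \notin S ->
    #|bad j :&: avoid S|%:R <= a * #|avoid S|%:R.
  move=> j S jY sS; apply: hbad; first exact: (fintype.subsetP sYi).
  exact: (fintype.subset_trans sS (finset.setUS _ sYi)).
have -> : X :|: Y = i |: (X :|: Y :\ i) by rewrite finset.setUCA finset.setD1K.
rewrite card_avoidU1 hY exprS.
have := hbad i (X :|: Y :\ i) iY (finset.setUS _ sYi).
rewrite !inE (negPf iX) eqxx /= => /(_ isT); rewrite hYi in IH.
move=> h1; rewrite -mulrA.
have := ler_wpM2l a1_ge0 IH; lra.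
Qed.

Lemma avoid_split (S : {set I}) (i : I) :
  (forall (j : I) (S' : {set I}), j \in S :&: N i -> S' \subset S -> j \notin S' ->
    #|bad j :&: avoid S'|%:R <= a * #|avoid S'|%:R) ->
  (1 - a) ^+ #|S :&: N i| * #|avoid (S :\: N i)|%:R <= #|avoid S|%:R.
Proof.
have eS : S :\: N i :|: S :&: N i = S by rewrite finset.setUC finset.setID.
move=> h; rewrite -[in leRHS]eS; apply: avoid_chain; first by rewrite eS.
rewrite -setI_eq0; apply/eqP/setP => j.
by rewrite !inE; case: (adj i j); rewrite ?andbF.
Qed.

(** Dropping the neighbours of [i] from the conditioning can only enlarge the set of outcomes, and
    [bad_indep] applies to what remains. *)
Lemma bad_avoid_le_nonadj (S : {set I}) (i : I) : i \notin S ->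
  #|bad i :&: avoid S|%:R <= p * #|avoid (S :\: N i)|%:R.
Proof.
move=> iS; apply: (le_trans _ (bad_indep (i := i) (S := S :\: N i) _ _)).
- by rewrite ler_nat subset_leq_card // finset.setIS // avoidS // finset.subsetDl.
- by rewrite !inE (negPf iS) andbF.
- by move=> j; rewrite !inE => /andP[].
Qed.

Lemma card_nbr_lt (S : {set I}) (i j : I) : adj j i -> i \notin S ->
  (#|S :&: N j| <= d.-1)%N.
Proof.
move=> ji iS; rewrite -ltnS (leq_trans _ (leqSpred d)) //.
apply: leq_trans (adj_deg j).
apply/proper_card/properP; split; first exact: finset.subsetIr.
by exists i; rewrite !inE ?(negPf iS).
Qed.

(* The bound [d.-1] holds along the induction because the vertex from which
   the neighbour [j] was reached stays outside the conditioning set. *)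
Lemma bad_avoid_le (S : {set I}) (i : I) : i \notin S ->
  (#|S :&: N i| <= d.-1)%N ->
  #|bad i :&: avoid S|%:R <= a * #|avoid S|%:R.
Proof.
move: {2}#|S|.+1 (ltnSn #|S|) => n; elim: n S i => [//|n IH] S i leSn iS degS.
have chain : (1 - a) ^+ #|S :&: N i| * #|avoid (S :\: N i)|%:R <= #|avoid S|%:R.
  apply: avoid_split => j S' /setIP[jS]; rewrite inE => ij sS' jS'.
  apply: IH => //.
    by apply: leq_trans (proper_card _) leSn; apply/properP; split=> //; exists j.
  apply: (@card_nbr_lt _ i); first by rewrite adj_sym.
  by apply: contra iS => /(fintype.subsetP sS').
apply: (le_trans (bad_avoid_le_nonadj iS)).
apply: (@le_trans _ _ (a * (1 - a) ^+ #|S :&: N i| * #|avoid (S :\: N i)|%:R)).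
  rewrite ler_wpM2r ?ler0n // (le_trans p_le) // ler_wpM2l //.
  exact: ler_wiXn2l.
by rewrite -mulrA ler_wpM2l.
Qed.

Lemma avoid_gt0 (S : {set I}) : (0 < #|avoid S|)%N.
Proof.
move: {2}#|S| (erefl #|S|) => n; elim: n S => [|n IH] S hS.
  move/eqP: hS; rewrite cards_eq0 => /eqP->.
  by rewrite /avoid big_set0 cardsT.
have /card_gt0P[i iS] : (0 < #|S|)%N by rewrite hS.
set T := S :\ i.
have hT : #|T| = n by move: hS; rewrite (cardsD1 i) iS add1n => -[].
have iT : i \notin T by rewrite !inE eqxx.
have chain : (1 - a) ^+ #|T :&: N i| * #|avoid (T :\: N i)|%:R <= #|avoid T|%:R.
  apply: avoid_split => j T' /setIP[_]; rewrite inE => ij sT' jT'.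
  apply: bad_avoid_le => //.
  apply: (@card_nbr_lt _ i); first by rewrite adj_sym.
  by apply: contra iT => /(fintype.subsetP sT').
have X_gt0 : 0 < #|avoid (T :\: N i)|%:R :> R.
  rewrite ltr0n (leq_trans (IH T hT)) // subset_leq_card // avoidS //.
  exact: finset.subsetDl.
rewrite -(@ltr0n R) -(finset.setD1K iS) card_avoidU1 subr_gt0.
apply: (le_lt_trans (bad_avoid_le_nonadj iT)).
apply: lt_le_trans chain; rewrite ltr_pM2r // (lt_le_trans p_lt) //.
apply: ler_wiXn2l => //.
by rewrite (leq_trans _ (adj_deg i)) // subset_leq_card // finset.subsetIr.
Qed.

End LocalLemma.

(** * Counting colorings *)

Section ColoringCounts.
Variables (T C : finType).

(* Swapping the values outside [A] of two colorings is an involution that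
   maps [X * Y] onto [(X :&: Y) * setT]. *)
Lemma card_determined_setI (A : {set T}) (X Y : {set {ffun T -> C}}) :
  (forall f g : {ffun T -> C}, (forall x, x \in A -> f x = g x) ->
     f \in X -> g \in X) ->
  (forall f g : {ffun T -> C}, (forall x, x \notin A -> f x = g x) ->
     f \in Y -> g \in Y) ->
  (#|X| * #|Y| = #|X :&: Y| * #|{ffun T -> C}|)%N.
Proof.
move=> hX hY; pose mix (f g : {ffun T -> C}) := [ffun x => if x \in A then f x else g x].
pose s u := (mix u.1 u.2, mix u.2 u.1).
have sK : involutive s.
  by move=> [f g]; congr pair; apply/ffunP => x; rewrite !ffunE /=; case: (x \in A).
rewrite -[#|{ffun T -> C}|]cardsT -!cardsX -(card_imset _ (can_inj sK)).
apply: eq_card => -[f g]; apply/imsetP/idP.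
  move=> [[f' g']]; rewrite !inE /= => /andP[fX gY] [-> _].
  rewrite andbT; apply/andP; split.
    by apply: hX fX => x xA; rewrite ffunE xA.
  by apply: hY gY => x xA; rewrite ffunE (negPf xA).
rewrite !inE /= andbT => /andP[fX fY]; exists (s (f, g)); last by rewrite sK.
rewrite !inE /=; apply/andP; split.
  by apply: hX fX => x xA; rewrite ffunE xA.
by apply: hY fY => x xA; rewrite ffunE (negPf xA).
Qed.

Definition rainbow (A : {set T}) : {set {ffun T -> C}} :=
  [set f : {ffun T -> C} | f @: A == [set: C]%SET]%SET.

Lemma card_ffun_imset_sub (A : {set T}) (J : {set C}) :
  (#|[set f : {ffun T -> C} | f @: A \subset J]%SET| =
     #|J| ^ #|A| * #|C| ^ #|~: A|%SET)%N.
Proof.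
pose F (x : T) := [pred c | (x \in A) ==> (c \in J)].
have -> : #|[set f : {ffun T -> C} | f @: A \subset J]%SET| = #|family F|.
  apply: eq_card => f; rewrite !inE; apply/fintype.subsetP/forallP => [sJ x|sJ c].
    by rewrite inE; apply/implyP => xA; apply: sJ; exact: imset_f.
  by move=> /imsetP[x xA ->]; have /implyP := sJ x; apply.
rewrite card_family foldrE big_map big_enum /= (bigID (mem A)) /=.
congr (_ * _)%N.
  rewrite -prod_nat_const; apply: eq_bigr => x xA.
  by apply: eq_card => c; rewrite unfold_in /= xA.
rewrite (eq_bigl (mem (~: A)%SET)) => [|x]; last by rewrite !inE.
rewrite -prod_nat_const; apply: eq_bigr => x; rewrite !inE => xA.
by apply: eq_card => c; rewrite unfold_in /= (negPf xA).
Qed.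

(* Inclusion-exclusion, by expanding the indicator of surjectivity as
   [\prod_i (1 - [i \notin f @: A])]. *)
Lemma card_rainbow (R : comNzRingType) (A : {set T}) :
  #|rainbow A|%:R = #|C|%:R ^+ #|~: A|%SET *
    \sum_(0 <= j < #|C|.+1)
       (-1) ^+ (#|C| - j) * 'C(#|C|, j)%:R * j%:R ^+ #|A| :> R.
Proof.
have indE (f : {ffun T -> C}) : (f \in rainbow A)%:R =
    \sum_(J : {set C}) (-1) ^+ (#|C| - #|J|) * (f @: A \subset J)%:R :> R.
  have -> : (f \in rainbow A)%:R = \prod_(i : C) (1 + - (i \notin f @: A)%:R) :> R.
    rewrite inE; case: eqP => [->|/eqP fA].
      by rewrite big1 // => i _; rewrite inE subr0.
    have [i hi] : exists i, i \notin f @: A.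
      apply/existsP; move: fA; apply: contraR; rewrite negb_exists => /forallP h.
      by rewrite finset.eqEsubset finset.subsetT; apply/fintype.subsetP => i _; move: (h i); rewrite negbK.
    by rewrite (bigD1 i) //= hi subrr mul0r.
  (* Expanding picks [1] for the colors in [J] and the negated indicator for the others; the product
     is nonzero only if every color outside [J] is missed, that is, [f @: A \subset J]. *)
  rewrite bigA_distr; apply: eq_bigr => J _.
  rewrite (bigID (mem J)) /= big1 ?mul1r => [|i ->//].
  rewrite (eq_bigr (fun i => -1 * (i \notin f @: A)%:R)) => [|i /negPf->]; last by rewrite mulN1r.
  rewrite big_split /=; congr (_ * _).
    by rewrite prodr_const -(cardC J) addKn.
  have [sJ|/subsetPn[i iA iJ]] := boolP (f @: A \subset J).
    rewrite big1 // => i iJ; suff -> : i \notin f @: A by [].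
    by apply: contra iJ => /(fintype.subsetP sJ).
  by rewrite (bigD1 i) //= iA mul0r.
rewrite -sum1_card natr_sum big_mkcond /=.
transitivity (\sum_f \sum_(J : {set C}) (-1) ^+ (#|C| - #|J|) *
    ((f : {ffun T -> C}) @: A \subset J)%:R : R).
  by apply: eq_bigr => f _; rewrite -indE; case: (_ \in _).
rewrite exchange_big /=.
transitivity (\sum_(J : {set C}) (-1) ^+ (#|C| - #|J|) *
    (#|J|%:R ^+ #|A| * #|C|%:R ^+ #|~: A|%SET) : R).
  apply: eq_bigr => J _; rewrite -mulr_sumr; congr (_ * _).
  rewrite -!natrX -natrM -card_ffun_imset_sub -sum1_card natr_sum [RHS]big_mkcond /=.
  by apply: eq_bigr => f _; rewrite inE; case: (_ \subset _).
(* Group the sets [J] by size; [inord] loses nothing because [#|J| <= #|C|]. *)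
rewrite (partition_big (fun J : {set C} => inord #|J| : 'I_#|C|.+1) predT) //=.
rewrite mulr_sumr big_mkord; apply: eq_bigr => j _.
have eqJ (J : {set C}) : (inord #|J| == j) = (#|J| == j).
  by rewrite -val_eqE /= inordK // ltnS max_card.
rewrite (eq_bigl _ _ eqJ).
rewrite (eq_bigr (fun=> (-1) ^+ (#|C| - j) *
   (j%:R ^+ #|A| * #|C|%:R ^+ #|~: A|%SET))) => [|J /eqP->//].
have -> : 'C(#|C|, j) = #|[pred J : {set C} | #|J| == j]|.
  by rewrite -card_draws; apply: eq_card => J; rewrite !inE.
rewrite sumr_const -mulr_natr; ring.
Qed.

End ColoringCounts.

(** * Numerical estimates for the rate [a] *)

Lemma one_minus_inv_expr_ge (R : realType) (n : nat) : (0 < n)%N ->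
  (expR 1)^-1 <= (1 - n.+1%:R^-1) ^+ n :> R.
Proof.
move=> n0; have n0R : 0 < n%:R :> R by rewrite ltr0n.
(* In reciprocals the claim becomes [(1 + 1/n)^n <= e], which is [1 + x <= exp x] at [x = 1/n]. *)
have -> : 1 - n.+1%:R^-1 = (1 + n%:R^-1)^-1 :> R.
  have h : n.+1%:R = n%:R + 1 :> R by rewrite -natr1.
  by rewrite h; field; rewrite !gt_eqF //; lra.
have pos : 0 < 1 + n%:R^-1 :> R by rewrite addr_gt0 // invr_gt0.
rewrite exprVn lef_pV2 ?posrE ?expR_gt0 ?exprn_gt0 //.
have -> : expR 1 = expR (n%:R^-1) ^+ n :> R.
  by rewrite -expRM_natl mulfV // gt_eqF.
by apply: lerXn2r; rewrite ?nnegrE ?expR_ge0 ?(ltW pos) //; exact: expR_ge1Dx.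
Qed.

(* For [2 <= d] one takes [a = 1 / d], otherwise [a = q]. *)
Lemma local_lemma_rate (R : realType) (q : R) (d : nat) :
  0 <= q < 1 -> d%:R * (expR 1 * q) <= 1 ->
  exists a : R, [/\ 0 <= a, a < 1, q <= a * (1 - a) ^+ d.-1 & q < (1 - a) ^+ d].
Proof.
move=> /andP[q0 q1] hd.
have e2 : 2 < expR 1 :> R by apply: expR_gt1Dx; rewrite oner_neq0.
case: d hd => [|[|n]] hd.
- by exists q; rewrite expr0 mulr1.
- exists q; rewrite expr0 expr1 mulr1; split=> //.
  (* From [e q <= 1] and [e > 2] follows [q < 1/2], hence [q < 1 - q]. *)
  by move: hd; rewrite mul1r => hd; nra.
- have hq : q <= (n.+2%:R)^-1 * (expR 1)^-1.
    by rewrite -invfM -[leRHS]mul1r ler_pdivlMr ?mulr_gt0 ?expR_gt0 // mulrC -mulrA.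
  have hpow := one_minus_inv_expr_ge R (ltn0Sn n).
  have n2 : n.+2%:R^-1 <= 2^-1 :> R by rewrite lef_pV2 ?posrE // ler_nat.
  have n20 : 0 < n.+2%:R^-1 :> R by rewrite invr_gt0.
  exists n.+2%:R^-1; rewrite /=; split; [exact: ltW|by apply: le_lt_trans n2 _; lra| |].
    by apply: le_trans hq _; rewrite ler_wpM2l // ltW.
  (* For [d >= 3] strictness comes from [1/d < 1 - 1/d]. For [d = 2] these are equal, and it comes
     from [e > 2] instead. *)
  apply: le_lt_trans hq _; case: n hd hpow n2 n20 => [|n] hd hpow n2 n20.
    have : (expR 1)^-1 < 2^-1 :> R by rewrite ltf_pV2 ?posrE ?expR_gt0.
    by rewrite expr2; lra.
  have n3 : n.+3%:R^-1 <= 3^-1 :> R by rewrite lef_pV2 ?posrE // ler_nat.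
  have e0 : 0 < (expR 1)^-1 :> R by rewrite invr_gt0 expR_gt0.
  move: (n.+3%:R^-1 : R) hpow n3 n20 => b hpow n3 b0.
  rewrite exprS; apply: (@lt_le_trans _ _ ((1 - b) * (expR 1)^-1)).
    by rewrite ltr_pM2r //; lra.
  by rewrite ler_wpM2l //; lra.
Qed.

(** * The probability of a missing color, and finite hypergraphs *)

Definition miss_prob (R : fieldType) (r k : nat) : R :=
  1 - 1 / k%:R ^+ r *
    \sum_(0 <= j < k.+1) (-1) ^+ (k - j) * 'C(k, j)%:R * j%:R ^+ r.

(** This identifies the expression of the theorem as a probability: the vertices outside [A]
    contribute a common factor that cancels. *)
Lemma card_rainboweC (R : realFieldType) (T C : finType) (A : {set T}) :
  (0 < #|C|)%N ->
  #|~: rainbow C A|%SET%:R = miss_prob R #|A| #|C| * #|{ffun T -> C}|%:R.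
Proof.
move=> C0; have hC : #|C|%:R != 0 :> R by rewrite pnatr_eq0 -lt0n.
have := cardsC (rainbow C A) => /(congr1 (fun n => n%:R : R)).
rewrite natrD card_rainbow card_ffun -(cardsC A) expnD natrM !natrX.
set s := \sum_(_ <= _ < _) _ => e; apply: (addrI (#|C|%:R ^+ #|~: A|%SET * s)).
rewrite e /miss_prob -/s; field.
by rewrite expf_neq0.
Qed.

(** The value is a proportion of the maps from [r] points to [k] colors, and it is below 1 because
    [k <= r] allows a surjection, here given by [inord]. *)
Lemma miss_prob_itv (R : realFieldType) (r k : nat) : (0 < k)%N -> (k <= r)%N ->
  0 <= miss_prob R r k < 1.
Proof.
case: k => // k _ kr.
have := @card_rainboweC R 'I_r 'I_k.+1 [set: 'I_r]%SET.
rewrite card_ord cardsT card_ord => /(_ isT) e.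
have N0 : 0 < #|{ffun 'I_r -> 'I_k.+1}|%:R :> R.
  by rewrite ltr0n card_ffun card_ord expn_gt0.
rewrite -(ler_pM2r N0) -(ltr_pM2r N0) mul0r mul1r -e ler0n ltr_nat /=.
rewrite -cardsT; apply/proper_card/properP; split; first exact: finset.subsetT.
exists [ffun x : 'I_r => inord x]; rewrite ?inE // negbK.
rewrite finset.eqEsubset finset.subsetT; apply/fintype.subsetP => i _.
apply/imsetP; exists (widen_ord kr i) => //; rewrite ffunE.
by apply: val_inj; rewrite /= inordK.
Qed.

Lemma finite_rainbow_coloring (R : realType) (T I : finType) (A : I -> {set T})
    (r k : nat) :
  (0 < k)%N -> (k <= r)%N -> (forall i, #|A i| = r) ->
  (forall i, #|[set j | (j != i) && ~~ [disjoint A i & A j]]%SET|%:R <=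
     1 / (expR 1 * miss_prob R r k)) ->
  exists f : {ffun T -> 'I_k}, forall i, f @: A i = [set: 'I_k]%SET.
Proof.
move=> k0 kr Ar degA; set q := miss_prob R r k in degA.
have /andP[q0 q1] := miss_prob_itv R k0 kr; rewrite -/q in q0 q1.
(* Degrees are integers, so the bound may be rounded down. As [1 / 0] is [0], the case [q = 0] gives
   [d = 0]. *)
pose d := Num.truncn (1 / (expR 1 * q)).
have x0 : 0 <= 1 / (expR 1 * q) by rewrite divr_ge0 // mulr_ge0 // expR_ge0.
have hd : d%:R * (expR 1 * q) <= 1.
  have [->|q_neq0] := eqVneq q 0; first by rewrite !mulr0 ler01.
  rewrite -ler_pdivlMr; first by rewrite truncn_le.
  by rewrite mulr_gt0 ?expR_gt0 // lt_neqAle eq_sym q_neq0.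
have [|a [a0 a1 qa qd]] := @local_lemma_rate R q d _ hd; first by rewrite q0.
pose adj := [rel i j : I | (j != i) && ~~ [disjoint A i & A j]].
have adj_sym : symmetric adj.
  by move=> i j /=; rewrite eq_sym disjoint_sym.
have adj_deg i : (#|[set j | adj i j]%SET| <= d)%N.
  by rewrite /d truncn_ge_nat //; exact: degA.
pose bad i := (~: rainbow 'I_k (A i))%SET.
have N0 : (0 < #|{ffun T -> 'I_k}|)%N by rewrite card_ffun card_ord expn_gt0 k0.
have indep (i : I) (S : {set I}) : i \notin S -> (forall j, j \in S -> ~~ adj i j) ->
    #|bad i :&: avoid bad S|%:R <= q * #|avoid bad S|%:R.
  move=> iS nadj; have N0R : 0 < #|{ffun T -> 'I_k}|%:R :> R by rewrite ltr0n.
  (* [bad i] depends only on the colors in [A i], and [avoid bad S] only on those outside it, since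
     each [A j] with [j] in [S] is disjoint from [A i]. *)
  rewrite -(ler_pM2r N0R) -natrM -(@card_determined_setI _ _ (A i)).
  - by rewrite natrM /bad card_rainboweC ?card_ord // Ar -/q mulrAC.
  - move=> f g fg; rewrite !inE => hf; apply: contra hf => /eqP <-; apply/eqP.
    exact: eq_in_imset.
  - move=> f g fg /bigcapP hf; apply/bigcapP => j jS; move: (hf j jS).
    rewrite !inE !negbK => /eqP <-; apply/eqP/eq_in_imset => x xA; rewrite fg //.
    apply: contraL xA => xA; move: (nadj j jS); rewrite /= negb_and !negbK.
    case/orP => [/eqP jj|dij]; first by rewrite -jj jS in iS.
    by rewrite (disjointFr dij xA).
have := avoid_gt0 adj_sym adj_deg indep a0 a1 qa qd N0 [set: I]%SET.
case/card_gt0P => f /bigcapP hf; exists f => i.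
by apply/eqP; have := hf i (finset.in_setT i); rewrite !inE negbK.
Qed.

(** * Infinite hypergraphs: compactness and finite subfamilies *)

Local Open Scope classical_set_scope.
Local Open Scope card_scope.
Local Open Scope ring_scope.

Lemma coloring_compact (V : choiceType) (k : nat) (E : set (set V)) :
  (forall A, E A -> finite_set A) ->
  finI E (fun A => [set c : V -> 'I_k | contains_all_colors c A]) ->
  exists c : V -> 'I_k, forall A, E A -> contains_all_colors c A.
Proof.
move=> finE /finI_filter FF; have [U [UU sU]] := ultraFilterLemma FF.
have UE A : E A -> U [set c : V -> 'I_k | contains_all_colors c A].
  move=> EA; apply: sU; exists [set c | contains_all_colors c A] => //.
  exact: finI_from1.
(* With finitely many colors, the ultrafilter must contain one of the color classes at [v]; its
   color is the limit color of [v]. *)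
have Uv (v : V) : exists i, U [set c : V -> 'I_k | c v = i].
  apply: contrapT => /forallNP nU.
  have : U set0.
    have : \forall c \near U, forall i : 'I_k, c v <> i.
      apply: filter_forall => i.
      by have [/nU|] := in_ultra_setVsetC [set c : V -> 'I_k | c v = i] UU.
    by apply: filterS => c /(_ (c v)).
  exact: filter_not_empty.
have [c cP] := choice Uv; exists c => A EA.
have [X AX] := finite_fsetP.1 (finE A EA).
(* Since [A] is finite, the colorings that agree with the limit on all of [A] still form a set in
   [U], so one of them also shows every color on [A]. *)
have UX : U (\bigcap_(v in [set` X]) [set c' : V -> 'I_k | c' v = c v]).
  by apply: filter_bigI => v _; exact: cP.
have [c' [cc' c'A]] := filter_ex (filterI UX (UE A EA)).
move=> i; have [v Av <-] := c'A i; exists v => //.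
by apply/esym/cc'; move: Av; rewrite AX.
Qed.

Lemma card_imset_val_le (V : choiceType) (F : {fset V}) (P : {set F})
    (B : set V) (n : nat) :
  (forall x : F, x \in P -> B (val x)) -> B #= `I_n -> (#|P| <= n)%N.
Proof.
move=> PB Bn; pose Q := [fset val x | x in P]%fset.
have QE : #|` Q| = #|P| by rewrite card_imfset ?cardE //; exact: val_inj.
have /card_eq_fsetP Qm := QE; rewrite -card_le_II -(card_le_eql Qm).
rewrite -(card_le_eqr Bn); apply: subset_card_le => x /= /imfsetP[y yP ->].
exact: PB.
Qed.

Lemma card_preim_val (V : choiceType) (F : {fset V}) (B : set V) (n : nat) :
  B `<=` [set` F] -> B #= `I_n -> #|[set x : F | val x \in B]%SET| = n.
Proof.
move=> BF Bn; rewrite -(card_fset_set Bn).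
have finB : finite_set B by apply/finite_setP; exists n.
transitivity #|` [fset val x | x in [set x : F | val x \in B]%SET]%fset|.
  by rewrite card_imfset ?cardE //; exact: val_inj.
congr (#|` _|); apply/fsetP => x; rewrite in_fset_set //.
apply/imfsetP/idP => [[y yB ->]|xB]; first by move: yB; rewrite !inE.
have xF : x \in F by apply: BF; rewrite inE in xB.
by exists [` xF]%fset => //; rewrite finset.in_set.
Qed.

(** The finite case applies to [D] on the union of its hyperedges: sizes are kept, and neighbours
    within [D] are neighbours within [E]. *)
Lemma finite_subfamily_coloring (R : realType) (r k : nat) (V : choiceType)
    (E : set (set V)) :
  (0 < k)%N -> (k <= r)%N -> (forall A, E A -> A #= `I_r) ->
  (forall A, E A -> card_at_most [set B | [/\ E B, B <> A & A `&` B !=set0]]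
     (1 / (expR 1 * miss_prob R r k))) ->
  finI E (fun A => [set c : V -> 'I_k | contains_all_colors c A]).
Proof.
move=> k0 kr uE degE D DE.
have EV (i : D) : E (val i) by have := DE _ (valP i); rewrite inE.
have : finite_set (\bigcup_(A in [set` D]) A).
  apply: bigcup_finite => // A AD; apply/finite_setP; exists r.
  by apply: uE; have := DE _ AD; rewrite inE.
move=> /finite_fsetP[X XE].
have sX (i : D) : val i `<=` [set` X].
  by rewrite -XE => x ix; exists (val i) => //=; exact: valP.
pose A (i : D) := [set x : X | val x \in val i]%SET.
have [||f hf] := @finite_rainbow_coloring R X D A r k k0 kr.
- by move=> i; apply: card_preim_val => //; exact: uE.
- move=> i; have [n nE nx] := degE _ (EV i).
  apply: le_trans nx; rewrite ler_nat; apply: card_imset_val_le nE => j.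
  rewrite inE => /andP[ji /pred0Pn[x /andP[/= xi xj]]]; split; first exact: EV.
    by move/val_inj/eqP; apply/negP.
  by exists (val x); split; [move: xi|move: xj]; rewrite finset.in_set => /set_mem.
(* Vertices outside the union get the arbitrary color [Ordinal k0]. *)
exists (fun v => if insub v is Some x then f x else Ordinal k0) => B BD.
move=> c; have : c \in f @: A [` BD]%fset by rewrite hf inE.
case/imsetP => x; rewrite finset.in_set => /set_mem xB ->.
by exists (val x) => //; rewrite valK.
Qed.

Theorem theorem14 (R : realType) (r k : nat) (H : hypergraph)
    (hk : (2 <= k)%N) (hr : (k <= r)%N) (hH : uniform r H)
    (hdeg : forall A : set (vertex H), hyperedges H A ->
       card_at_most (neighbors A)
         (1 / (expR 1 * (1 - 1 / k%:R ^+ r *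
            \sum_(0 <= j < k.+1)
               (-1) ^+ (k - j)%N * 'C(k, j)%:R * j%:R ^+ r)) : R)) :
  exists c : vertex H -> 'I_k,
    forall A : set (vertex H), hyperedges H A -> contains_all_colors c A.
Proof.
(* [{classic _}] equips the bare vertex type with the choice structure that finite sets require. *)
apply: (@coloring_compact {classic vertex H} k (hyperedges H)).
  by move=> A EA; apply/finite_setP; exists r; exact: hH.
exact: (@finite_subfamily_coloring R r k {classic vertex H} (hyperedges H) (ltnW hk) hr hH hdeg).
Qed.
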